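(* Let $d\ge 3$, and let $G$ be a closed non-compact subgroup of $\mathrm{Aut}(T_d)^{+}$ that acts $2$-transitively on $\partial T_d$. Then $G$ has property PL.
   Context: $T_d$ denotes the $d$-regular tree, $\mathrm{Aut}(T_d)$ its group of automorphisms with the compact-open topology (a locally compact group), and $\mathrm{Aut}(T_d)^{+}$ the group of type-preserving automorphisms, i.e. the index-$2$ subgroup of automorphisms preserving the two classes of the bipartition of the vertex set of $T_d$. $\partial T_d$ is the boundary of $T_d$, i.e. its set of endpoints (ideal points). A length function on a locally compact group $G$ is a function $L:G\to[0,\infty)$ that is bounded on compact subsets, symmetric ($L(g)=L(g^{-1})$) and subadditive ($L(gh)\le L(g)+L(h)$). It is proper if $\{g: L(g)\le R\}$ is relatively compact for every $R\ge 0$. $G$ has property PL if every length function on $G$ is either bounded or proper (equivalently, every locally bounded isometric action of $G$ on a metric space either has all orbits bounded or is metrically proper). *)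

(* Defs.v *)
From HB Require Import structures.
From mathcomp Require Import all_boot all_order all_algebra.
From mathcomp Require Import all_classical all_reals all_analysis.

Set Implicit Arguments.
Unset Strict Implicit.
Unset Printing Implicit Defensive.

Import Order.TTheory GRing.Theory Num.Theory.
Local Open Scope classical_set_scope.
Local Open Scope group_scope.

HB.mixin Record isTopologicalGroup G of Group G & Topological G := {
  mulg_continuous : continuous (fun gh : G * G => gh.1 * gh.2);
  invg_continuous : continuous (fun g : G => g^-1)
}.

#[short(type="topologicalGroupType")]
HB.structure Definition TopologicalGroup :=
  {G of isTopologicalGroup G & Group G & Topological G}.

Record subgroup (gT : groupType) := Subgroup {
  subgroup_set :> set gT;
  subgroup1 : subgroup_set 1;
  subgroupM : forall g h, subgroup_set g -> subgroup_set h ->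
    subgroup_set (g * h);
  subgroupV : forall g, subgroup_set g -> subgroup_set g^-1
}.

Section SubgroupGroup.
Variables (gT : groupType) (H : subgroup gT).

Definition subgroup_one : set_type H := SigSub (mem_set (@subgroup1 _ H)).

Definition subgroup_mul (g h : set_type H) : set_type H :=
  SigSub (mem_set (subgroupM (set_mem (valP g)) (set_mem (valP h)))).

Definition subgroup_inv (g : set_type H) : set_type H :=
  SigSub (mem_set (subgroupV (set_mem (valP g)))).

Fact subgroup_mulA : associative subgroup_mul.
Proof. by move=> x y z; apply: val_inj; rewrite /= mulgA. Qed.
Fact subgroup_mul1g : left_id subgroup_one subgroup_mul.
Proof. by move=> x; apply: val_inj; rewrite /= mul1g. Qed.
Fact subgroup_mulg1 : right_id subgroup_one subgroup_mul.
Proof. by move=> x; apply: val_inj; rewrite /= mulg1. Qed.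
Fact subgroup_mulVg : left_inverse subgroup_one subgroup_inv subgroup_mul.
Proof. by move=> x; apply: val_inj; rewrite /= mulVg. Qed.
Fact subgroup_mulgV : right_inverse subgroup_one subgroup_inv subgroup_mul.
Proof. by move=> x; apply: val_inj; rewrite /= mulgV. Qed.

HB.instance Definition _ := isGroup.Build (set_type H) subgroup_mulA
  subgroup_mul1g subgroup_mulg1 subgroup_mulVg subgroup_mulgV.

End SubgroupGroup.

Section SubgroupTopology.
Variables (gT : topologicalGroupType) (H : subgroup gT).

Let subgroup_nbhs (g : set_type H) (A : set (set_type H)) : nbhs g A ->
  exists2 B : set gT, nbhs (set_val g) B & set_val @^-1` B `<=` A.
Proof.
by move=> [_ [[B oB <-]] /= Bg BA]; exists B => //; exact: open_nbhs_nbhs.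
Qed.

Let val_cont : continuous (@set_val _ H : set_type H -> gT).
Proof. exact: initial_continuous. Qed.

Fact subgroup_mul_continuous :
  continuous (fun gh : set_type H * set_type H => gh.1 * gh.2).
Proof.
move=> [g h] A /subgroup_nbhs[B nB BA].
have [[P Q] /= [nP nQ] PQB] :=
  @mulg_continuous gT (set_val g, set_val h) B nB.
exists (set_val @^-1` P, set_val @^-1` Q).
  by split; [exact: (val_cont nP)|exact: (val_cont nQ)].
by move=> [g' h'] /= Pg'Qh'; apply: BA; exact: (PQB (set_val g', set_val h')).
Qed.

Fact subgroup_inv_continuous : continuous (fun g : set_type H => g^-1).
Proof.
move=> g A /subgroup_nbhs[B nB BA].
have : nbhs g (set_val @^-1` ((fun h : gT => h^-1) @^-1` B)).
  exact: (val_cont (@invg_continuous gT (set_val g) B nB)).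
have FF : Filter (nbhs g) by exact: nbhs_filter.
by move/(@filterS _ _ FF); apply => h Bh; exact: BA.
Qed.

HB.instance Definition _ := isTopologicalGroup.Build (set_type H)
  subgroup_mul_continuous subgroup_inv_continuous.

End SubgroupTopology.

Section LengthFunctions.
Variables (R : realType) (G : topologicalGroupType).
Local Open Scope ring_scope.

Definition is_length_function (L : G -> R) :=
  [/\ forall g, 0 <= L g,
      forall K : set G, compact K -> exists M, forall g, K g -> L g <= M,
      forall g, L g^-1%g = L g &
      forall g h, L (g * h)%g <= L g + L h].

Definition bounded_length (L : G -> R) := exists M, forall g, L g <= M.

Definition proper_length (L : G -> R) :=
  forall r, 0 <= r -> precompact [set g | L g <= r].

Definition property_PL :=
  forall L : G -> R, is_length_function L -> bounded_length L \/ proper_length L.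

End LengthFunctions.

Section Trees.
Variables (V : choiceType) (e : rel V).

Definition simple_graph := symmetric e /\ irreflexive e.

Definition connected_graph :=
  (exists x : V, True) /\
  forall x y, exists2 p : seq V, path e x p & last x p = y.

(* Closed walks of length at most 2 are not cycles of a simple graph. *)
Definition acyclic_graph := forall c : seq V, ucycle e c -> (size c < 3)%N.

Definition tree := [/\ simple_graph, connected_graph & acyclic_graph].

Definition regular_graph (d : nat) := forall x, ([set y | e x y] #= `I_d)%card.

Definition regular_tree (d : nat) := tree /\ regular_graph d.

(* One class [A] of a bipartition, the other one being [~` A]. *)
Definition bipartition (A : set V) := forall x y, e x y -> A x <-> ~ A y.

Definition ray (r : nat -> V) := (forall n, e (r n) (r n.+1)) /\ injective r.

Definition cofinal (r s : nat -> V) :=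
  exists m n, forall k, r (m + k)%N = s (n + k)%N.

(* An end is an equivalence class of rays for the relation [cofinal]. *)
Definition end_of (r : nat -> V) : set (nat -> V) :=
  [set s | ray s /\ cofinal r s].

Definition boundary : set (set (nat -> V)) := end_of @` ray.

End Trees.

Record aut (V : choiceType) (e : rel V) := Aut {
  aut_fun :> V -> V;
  aut_inv : V -> V;
  aut_funK : cancel aut_fun aut_inv;
  aut_invK : cancel aut_inv aut_fun;
  aut_edge : forall x y, e (aut_fun x) (aut_fun y) = e x y
}.

Section AutGroup.
Variables (V : choiceType) (e : rel V).
Implicit Types g h : aut e.

Lemma aut_eq g h : (g : V -> V) = h -> g = h.
Proof.
case: g h => [g g' gK g'K ge] [h h' hK h'K he] /= gh; subst h.
have gh' : g' = h' by apply/funext => x; rewrite -[x in LHS]h'K gK.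
by subst h'; congr Aut; exact: Prop_irrelevance.
Qed.

HB.instance Definition _ := gen_eqMixin (aut e).
HB.instance Definition _ := gen_choiceMixin (aut e).

Definition aut1 : aut e := @Aut V e id id (fun=> erefl) (fun=> erefl)
  (fun _ _ => erefl).

Fact autM_edge g h x y : e ((g \o h) x) ((g \o h) y) = e x y.
Proof. by rewrite /= !aut_edge. Qed.

Definition autM g h : aut e := Aut (can_comp (aut_funK g) (aut_funK h))
  (can_comp (aut_invK h) (aut_invK g)) (autM_edge g h).

Fact autV_edge g x y : e (aut_inv g x) (aut_inv g y) = e x y.
Proof. by rewrite -(aut_edge g) !aut_invK. Qed.

Definition autV g : aut e := Aut (aut_invK g) (aut_funK g) (autV_edge g).

Fact autMA : associative autM.
Proof. by move=> f g h; exact: aut_eq. Qed.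
Fact aut1M : left_id aut1 autM.
Proof. by move=> g; exact: aut_eq. Qed.
Fact autM1 : right_id aut1 autM.
Proof. by move=> g; exact: aut_eq. Qed.
Fact autVM : left_inverse aut1 autV autM.
Proof. by move=> g; apply: aut_eq; apply/funext => x; exact: aut_funK. Qed.
Fact autMV : right_inverse aut1 autV autM.
Proof. by move=> g; apply: aut_eq; apply/funext => x; exact: aut_invK. Qed.

HB.instance Definition _ := isGroup.Build (aut e) autMA aut1M autM1 autVM autMV.

(* The compact-open topology, the vertex set being discrete. *)
Definition aut_embed (g : aut e) :
  {compact-open, discrete_topology V -> discrete_topology V} := g.

HB.instance Definition _ :=
  Topological.copy (aut e) (initial_topology aut_embed).

Let aut_cvg (F : set_system (aut e)) g : Filter F ->
  (forall x, F [set h : aut e | h x = g x]) -> F --> g.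
Proof.
move=> FF Fg A [_ [[B oB <-]] /= Bg BA].
apply: filterS BA _.
suff : aut_embed @ F --> aut_embed g by apply; exact: open_nbhs_nbhs.
apply/compact_open_cvgP => K O cK _ gKO.
suff : \forall h \near F, K `<=` (fun x => (h : aut e) x = g x).
  move=> KF; near=> h => _ [x Kx <-]; apply: gKO; exists x => //.
  by apply/esym; move: x Kx; near: h.
apply: (iffLR (compact_near_coveringP K) cK) => x Kx.
exists ([set x], [set h : aut e | h x = g x]).
  by split; [exact: discrete_set1|exact: Fg].
by move=> [_ h] [/= -> ->].
Unshelve. all: by end_near. Qed.

Lemma nbhs_aut g x : nbhs g [set h : aut e | h x = g x].
Proof.
exists [set h : aut e | h x = g x]; split => //.
exists [set f : {compact-open, discrete_topology V -> discrete_topology V} |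
  f @` [set x] `<=` [set g x]].
  by apply: compact_open_open; [exact: compact_set1|exact: discrete_open].
apply/seteqP; split => h /=; first by move=> /(_ (h x)); apply; exists x.
by move=> hx _ [_ -> <-].
Qed.

Fact autM_continuous : continuous (fun gh : aut e * aut e => gh.1 * gh.2).
Proof.
move=> [g h]; apply: aut_cvg => x.
exists ([set g' : aut e | g' (h x) = g (h x)], [set h' : aut e | h' x = h x]).
  by split; exact: nbhs_aut.
by move=> [g' h'] [/= g'E h'E]; rewrite /= -g'E -h'E.
Qed.

Fact autV_continuous : continuous (fun g : aut e => g^-1).
Proof.
move=> g; have FF : Filter ((fun h : aut e => h^-1) @ g).
  exact: (fmap_filter _ (nbhs_filter g)).
apply: aut_cvg => x.
apply: filterS (nbhs_aut g (aut_inv g x)) => h /=.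
by rewrite aut_invK => {1}<-; exact: aut_funK.
Qed.

HB.instance Definition _ := isTopologicalGroup.Build (aut e)
  autM_continuous autV_continuous.

(* A connected graph has at most one bipartition, and [g] preserves [A] iff it
   preserves [~` A]. *)
Definition type_preserving : set (aut e) :=
  [set g | exists2 A, bipartition e A & g @` A = A].

Definition end_act g (xi : set (nat -> V)) : set (nat -> V) :=
  [set g \o r | r in xi].

Definition two_transitive_on_boundary (G : set (aut e)) :=
  forall x1 x2 y1 y2,
    boundary e x1 -> boundary e x2 -> boundary e y1 -> boundary e y2 ->
    x1 <> x2 -> y1 <> y2 ->
    exists2 g, G g & end_act g x1 = y1 /\ end_act g x2 = y2.

End AutGroup.

Arguments type_preserving {V} e _.

(* Main.v *)
Require Import Defs.
From HB Require Import structures.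
From mathcomp Require Import all_boot all_order all_algebra zify.
From mathcomp Require Import all_classical all_reals all_analysis.
Local Open Scope classical_set_scope.

(** Fix a vertex [x] with stabiliser [K] in [G]. The whole argument rests on two
    facts. By local finiteness and closedness of [G], the set of elements
    displacing [x] by at most [n] is compact ([displacement_compact]). And [K]
    is transitive on each sphere centred at [x] ([sphere_transitive]).

    Suppose that a length function [L] is not proper. Then for some [r] the set
    where [L <= r] is not contained in any of these compact sets, so it contains
    elements [g] displacing [x] arbitrarily far. Given any [h] in [G], choose
    such a [g] with [d(x, g x) >= d(x, h x)]. The point [k g x], for [k] in [K],
    can be placed anywhere on the sphere of radius [d(x, g x)], hence at any
    even distance up to [2 d(x, g x)] from [g^-1 x]; so [g k g] can be made to
    displace [x] exactly as far as [h], which is an even distance since types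
    are preserved. Sphere transitivity then yields [h = k1 g k2 g k3] with all
    [ki] in [K] ([product_reaches]), so [L h <= 2 r + 3 sup_K L]: the function
    [L] is bounded.

    Sphere transitivity comes from translations. Two-transitivity on the
    boundary says that [G] permutes the geodesic lines transitively, up to a
    shift of the parameter ([line_transitive]). If one element of [G] translates
    a line by [tau > 0], conjugation gives, for every line, an element
    translating it by the same [tau] ([uniform_translations]). Given [y] and
    [y'] at the same distance [n] from [x], take lines [l] and [l'] through [x],
    one passing through [y], the other through [y'], with the same negative
    half, and translations [t], [t'] along them. Then [t' ^+ n * t ^- n] pushes
    [l] into the common half and back out along [l'], so it fixes [x] and sends
    [y] to [y'].

    An element with even displacements and no fixed vertex translates a line,
    namely any line assembled from the images of a segment of minimal
    displacement ([axis]). To find such an element in [G]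
    ([exists_no_fixpoint]), reverse a line [l] by some [s] in [G], normalised
    to fix [l 1], and let [l'] leave [l] at [l 0]. Some [g] in [G] carries
    [l k] to [l' (k + a)] for a constant [a]. If [a] is not zero, [g] shifts
    a ray along itself and fixes no vertex. If it is, then [s] and its
    conjugate by [g] fix two different neighbours of [l 0] but move [l 0],
    and a ping-pong argument shows that their product fixes no vertex. *)

Set Implicit Arguments.
Unset Strict Implicit.
Unset Printing Implicit Defensive.

(** * Distance in a tree *)

Section Tree.
Variables (V : choiceType) (e : rel V).

Definition joined (x y : V) : pred nat :=
  fun n => `[< exists p, [/\ path e x p, last x p = y & size p = n] >].

Definition gdist (x y : V) : nat :=
  if pselect (exists n, joined x y n) is left xy then ex_minn xy else 0.

Hypothesis treeV : tree e.

Lemma edge_sym : symmetric e. Proof. by case: treeV => -[]. Qed.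

Lemma edge_irr x : e x x = false. Proof. by case: treeV => -[_ ->]. Qed.

Lemma gdist_path x y :
  exists p, [/\ path e x p, last x p = y & size p = gdist x y].
Proof.
rewrite /gdist; case: pselect => [xy|[]].
  by case: ex_minnP => n /asboolP.
case: treeV => _ [_ /(_ x y)[p ep py]] _.
by exists (size p); apply/asboolP; exists p.
Qed.

Lemma gdist_le_size x p : path e x p -> gdist x (last x p) <= size p.
Proof.
move=> ep; rewrite /gdist; case: pselect => [xy|//].
by case: ex_minnP => n _; apply; apply/asboolP; exists p.
Qed.

Lemma gdistxx x : gdist x x = 0.
Proof. by apply/eqP; rewrite -leqn0 (@gdist_le_size x [::]). Qed.

Lemma gdist_eq0 x y : gdist x y = 0 -> x = y.
Proof. by have [p [_ <- <-]] := gdist_path x y; case: p. Qed.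

Lemma gdist_triangle x y z : gdist x z <= gdist x y + gdist y z.
Proof.
have [p [ep py <-]] := gdist_path x y; have [q [eq qz <-]] := gdist_path y z.
by rewrite -size_cat -qz -py -last_cat gdist_le_size // cat_path ep py.
Qed.

Lemma gdistC x y : gdist x y = gdist y x.
Proof.
suff le a b : gdist b a <= gdist a b by apply/eqP; rewrite eqn_leq !le.
have [p [ep pb <-]] := gdist_path a b.
have <- : last b (rev (belast a p)) = a.
  by case: p pb {ep} => //= c p _; rewrite rev_cons last_rcons.
rewrite -(size_belast a p) -size_rev gdist_le_size // -pb rev_path.
by rewrite (eq_path (e' := e)) // => u v; rewrite edge_sym.
Qed.

Lemma gdist_edge y z : e y z -> gdist y z <= 1.
Proof. by move=> eyz; apply: (@gdist_le_size y [:: z]); rewrite /= eyz. Qed.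

Lemma exists_closer x y :
  y != x -> exists2 z, e y z & gdist x y = (gdist x z).+1.
Proof.
move=> yx; have [[|z p] /= [ep px sp]] := gdist_path y x.
  by rewrite px eqxx in yx.
case/andP: ep => eyz ep; exists z => //.
have := gdist_le_size ep; rewrite px.
have := gdist_triangle x z y; have := gdist_edge eyz.
rewrite (gdistC x y) (gdistC x z) (gdistC z y); lia.
Qed.

(** If [z] and [z'] were different, geodesics from them to [x] would avoid
    [y], and joining them at [x] would close a cycle through [y]. Together
    with [exists_closer] this is all that is used of acyclicity: seen from
    any vertex [x], a tree is rooted. *)
Lemma closer_unique x y z z' : e y z -> e y z' ->
  gdist x z <= gdist x y -> gdist x z' <= gdist x y -> z = z'.
Proof.
have avoid w : e y w -> gdist x w <= gdist x y ->
    exists p, [/\ path e w p, last w p = x & y \notin w :: p].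
  move=> eyw lexw; have [p [ep px sp]] := gdist_path w x; exists p; split=> //.
  rewrite inE negb_or; apply/andP; split.
    by apply: contraTneq eyw => ->; rewrite edge_irr.
  apply/negP => yp; case/splitPr: yp ep px sp => p1 p2.
  rewrite cat_path last_cat size_cat /= => /and3P[_ _ ep2] px.
  have := gdist_le_size ep2; rewrite px (gdistC y x) (gdistC w x); lia.
move=> eyz eyz' /(avoid _ eyz)[p [ep px yp]] /(avoid _ eyz')[q [eq qx yq]].
have [r [er rz' yr]] :
    exists r, [/\ path e z r, last z r = z' & y \notin z :: r].
  exists (p ++ rev (belast z' q)); split.
  - rewrite cat_path ep px -qx rev_path.
    by rewrite (eq_path (e' := e)) // => u v; rewrite edge_sym.
  - rewrite last_cat px; case: q qx {eq yq} => //= w q _.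
    by rewrite rev_cons last_rcons.
  - rewrite -cat_cons mem_cat negb_or yp mem_rev /=.
    by apply: contra yq; exact: mem_belast.
case/shortenP: er rz' => s es us sr sz'.
have cyc : ucycle e [:: y, z & s].
  apply/andP; split; rewrite /=.
    by rewrite eyz rcons_path es sz' edge_sym.
  rewrite -/(uniq (z :: s)) us andbT; apply: contra yr; rewrite !inE.
  by case/orP => [->//|/sr ->]; rewrite orbT.
by case: treeV => _ _ /(_ _ cyc); case: s sz' {es us sr cyc}.
Qed.

(** Adjacent vertices cannot be equidistant from [x]: the farther end of the
    edge would have two neighbours that are not farther than itself. *)
Lemma gdist_edgeE x y z : e y z ->
  gdist x z = (gdist x y).+1 \/ gdist x y = (gdist x z).+1.
Proof.
move=> eyz; have lezy := gdist_triangle x y z.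
have leyz := gdist_triangle x z y; have le1 := gdist_edge eyz.
rewrite (gdistC z y) in leyz.
have [xz|] := eqVneq (gdist x z) (gdist x y); last lia.
have [yx|/exists_closer[w eyw xw]] := eqVneq y x.
  move: xz; rewrite yx gdistxx => /gdist_eq0 xz.
  by rewrite yx -xz edge_irr in eyz.
have zw : z = w by apply: (@closer_unique x y z w) => //; lia.
by move: xw; rewrite -zw xz; lia.
Qed.

(** Moving from [u] and from [v] one step towards [b], one arrives by
    induction at the same vertex, whose neighbour closer to [a] is unique. *)
Lemma between_unique a b u v : gdist a u + gdist u b = gdist a b ->
  gdist a v = gdist a u -> gdist v b = gdist u b -> u = v.
Proof.
elim: {u}(gdist u b) {-2}u (erefl (gdist u b)) v => [|n IH] u ub v aub av vb.
  by rewrite (gdist_eq0 ub) (gdist_eq0 (etrans vb ub)).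
have closer w : gdist w b = n.+1 -> exists2 w', e w w' & gdist w' b = n.
  move=> wb; have /exists_closer[w' eww'] : w != b.
    by apply: contraPneq wb => ->; rewrite gdistxx.
  by rewrite gdistC wb (gdistC b) => -[nw']; exists w'.
have [u' euu' u'b] := closer u ub.
have [v' evv' v'b] := closer v (etrans vb ub).
have far w w' : gdist a w = gdist a u -> e w w' -> gdist w' b = n ->
    gdist a w' = (gdist a w).+1.
  move=> aw eww' w'b; have [//|aw'] := gdist_edgeE a eww'.
  by have := gdist_triangle a w' b; lia.
have au' := far u u' erefl euu' u'b; have av' := far v v' av evv' v'b.
have uv' : u' = v' by apply: IH => //; lia.
apply: (@closer_unique a u'); rewrite ?(edge_sym u') //; first by rewrite uv'.
  by rewrite au'.
by rewrite au' av.
Qed.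

(** * Rays and geodesic lines *)

Definition reduced (r : nat -> V) :=
  (forall n, e (r n) (r n.+1)) /\ (forall n, r n <> r n.+2).

(** In a tree the local condition of not backtracking is enough for a walk to
    be geodesic: the only neighbour of [r k.+1] closer to [r i] is [r k]. *)
Lemma reduced_gdist r i n : reduced r -> gdist (r i) (r (i + n)) = n.
Proof.
case=> er br; elim/ltn_ind: n => -[_|[_|n IH]]; first by rewrite addn0 gdistxx.
  have := gdist_edge (er i); rewrite addn1.
  case E : (gdist _ _) => [|[|//]] // _.
  by have := er i; rewrite (gdist_eq0 E) edge_irr.
have d0 : gdist (r i) (r (i + n)) = n by apply: IH; lia.
have d1 : gdist (r i) (r (i + n).+1) = n.+1 by rewrite -addnS IH.
rewrite !addnS.
have [->|lt] := gdist_edgeE (r i) (er (i + n).+1); first by rewrite d1.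
case: (br (i + n)).
apply: (@closer_unique (r i) (r (i + n).+1)) => //; last lia.
  by rewrite edge_sym.
by rewrite d0 d1.
Qed.

Lemma away_reduced x r : (forall n, e (r n) (r n.+1)) ->
  (forall n, gdist x (r n) = gdist x (r 0) + n) -> reduced r.
Proof.
move=> er xr; split=> // n /(congr1 (gdist x)).
rewrite (xr n) (xr n.+2); lia.
Qed.

Definition geodesic_line (l : int -> V) :=
  forall i j : int, gdist (l i) (l j) = `|i - j|%N.

Lemma geodesic_lineP l : (forall k : int, e (l k) (l (k + 1)%R)) ->
  (forall k : int, l k <> l (k + 2)%R) -> geodesic_line l.
Proof.
move=> el bl i j; wlog le_ij : i j / (i <= j)%R.
  move=> W; have [/W->//|/W] : (i <= j)%R \/ (j <= i)%R by lia.
  by rewrite gdistC => ->; lia.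
pose r n := l (i + n%:Z)%R.
have rr : reduced r.
  split=> n; rewrite /r.
    by have := el (i + n%:Z)%R; congr (e _ (l _)); lia.
  by have := bl (i + n%:Z)%R; congr (_ <> l _); lia.
have := reduced_gdist 0 `|j - i|%N rr.
have -> : r 0 = l i by congr l; lia.
have -> : r (0 + `|j - i|)%N = l j by congr l; lia.
by lia.
Qed.

Lemma geodesic_line_edge l (k : int) : geodesic_line l -> e (l k) (l (k + 1)%R).
Proof.
move=> ll; have := ll k (k + 1)%R.
have -> : `|k - (k + 1)%R|%N = 1 by lia.
have [p [ep <- <-]] := gdist_path (l k) (l (k + 1)%R).
by case: p ep => [|z [|]] //= /andP[].
Qed.

Lemma geodesic_line_inj l : geodesic_line l -> injective l.
Proof. by move=> ll i j eij; have := ll i j; rewrite eij gdistxx; lia. Qed.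

Lemma geodesic_line_shift l c : geodesic_line l ->
  geodesic_line (fun k => l (k + c)%R).
Proof. by move=> ll i j; rewrite ll; lia. Qed.

Lemma geodesic_line_opp l :
  geodesic_line l -> geodesic_line (fun k => l (- k)%R).
Proof. by move=> ll i j; rewrite ll; lia. Qed.

Lemma geodesic_line_half l : geodesic_line l ->
  reduced (fun n => l (Posz n)) /\ reduced (fun n => l (- n%:Z)%R).
Proof.
move=> ll; split; split=> n.
- by have := geodesic_line_edge n ll; congr (e _ (l _)); lia.
- by move/(geodesic_line_inj ll); lia.
- rewrite edge_sym; have := geodesic_line_edge (- n.+1%:Z)%R ll.
  by congr (e _ (l _)); lia.
- by move/(geodesic_line_inj ll); lia.
Qed.

Definition glue (q r : nat -> V) (k : int) : V :=
  match k with Posz n => r n | Negz n => q n.+1 end.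

Lemma glue_line q r : reduced q -> reduced r -> q 0 = r 0 -> q 1 <> r 1 ->
  geodesic_line (glue q r).
Proof.
move=> [eq bq] [er br] qr0 qr1; apply: geodesic_lineP => -[n|[|[|n]]] //=.
- by rewrite addn1.
- by rewrite -qr0 edge_sym.
- by rewrite edge_sym; exact: eq.
- by rewrite edge_sym; exact: eq.
- by rewrite addn2.
- by rewrite -qr0; exact: nesym (bq 0).
- by rewrite subn2; exact: nesym (bq n.+1).
Qed.

Lemma geodesic_line_rays l : geodesic_line l ->
  ray e (fun n => l (Posz n)) /\ ray e (fun n => l (- n%:Z)%R).
Proof.
move=> ll; have [[ep _] [en _]] := geodesic_line_half ll.
by split; split=> // m n /(geodesic_line_inj ll); lia.
Qed.

Lemma geodesic_line_ends l : geodesic_line l ->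
  end_of e (fun n => l (Posz n)) <> end_of e (fun n => l (- n%:Z)%R).
Proof.
move=> ll eq_ends; have [_ rn] := geodesic_line_rays ll.
have : end_of e (fun n => l (- n%:Z)%R) (fun n => l (- n%:Z)%R).
  by split=> //; exists 0, 0.
rewrite -eq_ends => -[_ [m [n /(_ 1)/(geodesic_line_inj ll)]]]; lia.
Qed.

(** Lines eventually agreeing in both directions agree everywhere, because a
    vertex between two others is determined by its distances to them.
    Comparing lengths of long segments shows that the shifts at the two ends
    are the same. *)
Lemma lines_same_ends l l' : geodesic_line l -> geodesic_line l' ->
  cofinal (fun n => l' (Posz n)) (fun n => l (Posz n)) ->
  cofinal (fun n => l' (- n%:Z)%R) (fun n => l (- n%:Z)%R) ->
  exists c : int, forall k, l k = l' (k + c)%R.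
Proof.
move=> ll ll' [m [n pos]] [m' [n' neg]]; exists (m%:Z - n%:Z)%R => k.
have mn : m + m' = n + n'.
  have := ll (Posz n) (- n'%:Z)%R; have := ll' (Posz m) (- m'%:Z)%R.
  by have := pos 0; have := neg 0; rewrite !addn0 => -> ->; lia.
(* [N] is large enough for [k] to lie, on both lines, between the two
   places where they are known to agree. *)
pose N := `|k|%N + m + m' + n + n'.
have lN : l (Posz (n + N)) = l' (Posz (m + N)) by rewrite -pos.
have lN' : l (- (n' + N)%N%:Z)%R = l' (- (m' + N)%N%:Z)%R by rewrite -neg.
apply: (@between_unique (l (- (n' + N)%N%:Z)%R) (l (Posz (n + N)))).
- by rewrite !ll; lia.
- by rewrite ll lN' ll'; lia.
- by rewrite ll lN ll'; lia.
Qed.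

(** * Automorphisms and their fixed vertices *)

Implicit Types g h s t : aut e.

Lemma autME g h x : (g * h)%g x = g (h x). Proof. by []. Qed.

Lemma autKV g x : g^-1%g (g x) = x. Proof. exact: aut_funK. Qed.

Lemma autVK g x : g (g^-1%g x) = x. Proof. exact: aut_invK. Qed.

Lemma aut_inj g : injective g. Proof. exact: can_inj (aut_funK g). Qed.

Lemma aut_gdist g x y : gdist (g x) (g y) = gdist x y.
Proof.
have le h a b : gdist (h a) (h b) <= gdist a b.
  have [p [ep <- <-]] := gdist_path a b.
  rewrite -(size_map h) -last_map gdist_le_size //.
  by rewrite path_map (eq_path (e' := e)) // => u v; rewrite /= aut_edge.
apply/eqP; rewrite eqn_leq le /=.
by have := le g^-1%g (g x) (g y); rewrite !autKV.
Qed.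

(** The parity of the distance tells whether two vertices are in the same
    class of the bipartition. *)
Lemma type_preserving_even g x : type_preserving e g -> ~~ odd (gdist x (g x)).
Proof.
case=> A bipA gA.
have parity n y : gdist x y = n -> `[< A y >] = `[< A x >] (+) odd n.
  elim: n y => [|n IH] y xy; first by rewrite (gdist_eq0 xy) addbF.
  have yx : y != x by apply: contraPneq xy => ->; rewrite gdistxx.
  have [z eyz] := exists_closer yx; rewrite xy => -[nz].
  rewrite /= addbN -(IH z) // -asbool_neg.
  by apply: asbool_equiv_eq; exact: bipA.
have := parity _ (g x) erefl.
have -> : `[< A (g x) >] = `[< A x >].
  apply: asbool_equiv_eq; split=> [|Ax]; rewrite -{1}gA.
    by move=> [y Ay /aut_inj <-].
  by exists x.
by case: `[< A x >]; case: odd.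
Qed.

(** Ping-pong. Removing [o] leaves [c] and [c'] in different branches. The
    element [s] fixes [c] and moves its neighbour [o], so it sends everything
    outside the branch of [c] into that branch; the same holds for [s'] and
    [c']. If [s * s'] fixed [u], then [u] and [s' u] would lie in the two
    branches, at equal distances from [c] and at equal distances from [c'],
    which is absurd as [c] and [c'] are at distance 2. *)
Lemma two_reflections_no_fixpoint s s' o c c' :
  e c o -> e c' o -> c <> c' -> s c = c -> s' c' = c' ->
  s o <> o -> s' o <> o -> forall u, (s * s')%g u <> u.
Proof.
(* The neighbour of [b = g b] closer to [g u] is [g o], hence not [o]. *)
have flip g b u : e b o -> g b = b -> g o <> o ->
    gdist u b = (gdist u o).+1 -> gdist (g u) o = (gdist (g u) b).+1.
  move=> ebo gb go ub; have [//|ub'] := gdist_edgeE (g u) ebo.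
  have ebgo : e b (g o) by rewrite -gb aut_edge.
  have gub : gdist (g u) b = gdist u b by rewrite -{1}gb aut_gdist.
  case: go; apply: (@closer_unique (g u) b) => //; last lia.
  by rewrite aut_gdist; lia.
move=> eco ec'o cc' sc s'c' so s'o u ssu.
have [w wE] : exists w, w = s' u by exists (s' u).
have ws : s w = u by rewrite wE.
have uw : gdist u c = gdist w c by rewrite -ws -{1}sc aut_gdist.
have wu : gdist w c' = gdist u c' by rewrite wE -{1}s'c' aut_gdist.
have opposite v : gdist v o = (gdist v c).+1 -> gdist v c' = (gdist v o).+1.
  rewrite edge_sym in eco; rewrite edge_sym in ec'o.
  move=> vc; have [//|vc'] := gdist_edgeE v ec'o.
  by case: cc'; apply: (@closer_unique v o); rewrite // ?vc ?vc'; lia.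
have [uc|uc] := gdist_edgeE u eco.
  have uc' := opposite _ uc.
  have wc' := flip s' c' u ec'o s'c' s'o uc'; rewrite -wE in wc'.
  have [wc|wc] := gdist_edgeE w eco; first by have := opposite _ wc; lia.
  lia.
have [wc|wc] := gdist_edgeE w eco.
  have wc' := opposite _ wc; have [uc'|uc'] := gdist_edgeE u ec'o; first lia.
  by have := flip s' c' u ec'o s'c' s'o uc'; rewrite -wE; lia.
by have := flip s c w eco sc so wc; rewrite ws; lia.
Qed.

(** A fixed vertex would have the same distance to infinitely many vertices
    of the negative half of [l], which escape to infinity. *)
Lemma shift_ray_no_fixpoint g l (a : int) : geodesic_line l -> a <> 0%R ->
  (forall k : int, (k <= 0)%R -> (k + a <= 0)%R -> g (l k) = l (k + a)%R) ->
  forall u, g u <> u.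
Proof.
move=> ll a0 gl u gu.
have step k : (k <= 0)%R -> (k + a <= 0)%R ->
    gdist u (l (k + a)%R) = gdist u (l k).
  by move=> k0 ka0; rewrite -gl // -{1}gu aut_gdist.
have const n : gdist u (l (- (n * `|a|)%N%:Z)%R) = gdist u (l 0%R).
  elim: n => [|n <-]; first by rewrite mul0n GRing.oppr0.
  have [a_gt0|a_lt0] : (0 < a)%R \/ (a < 0)%R by lia.
    have -> : (- (n * `|a|)%N%:Z = - (n.+1 * `|a|)%N%:Z + a)%R by lia.
    by rewrite step //; lia.
  have -> : (- (n.+1 * `|a|)%N%:Z = - (n * `|a|)%N%:Z + a)%R by lia.
  by rewrite step //; lia.
pose n := (gdist u (l 0%R)).*2.+1.
have := gdist_triangle (l 0%R) u (l (- (n * `|a|)%N%:Z)%R).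
rewrite /n const ll (gdistC _ u).
have : 0 < `|a|%N by lia.
nia.
Qed.

Definition int_power t (k : int) : aut e :=
  (match k with Posz n => t ^+ n | Negz n => t ^- n.+1 end)%g.

Lemma int_powerD1 t k : int_power t (k + 1)%R = (int_power t k * t)%g.
Proof.
case: k => [n|[|n]] /=; first by rewrite addn1 expgSr.
  by rewrite expg1 mulVg.
by rewrite subn1 /= [in RHS]expgS invgM -mulgA mulVg mulg1.
Qed.

Lemma int_power_comm t k : commute (int_power t k) t.
Proof.
case: k => n /=; first exact: commute_sym (commuteX _ (commute_refl t)).
exact: commute_sym (commuteV (commuteX _ (commute_refl t))).
Qed.

Lemma iter_translation t l tau n k :
  (forall k : int, t (l k) = l (k + tau%:Z)%R) ->
  (t ^+ n)%g (l k) = l (k + (n * tau)%N%:Z)%R.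
Proof.
move=> tl; elim: n => [|n IH]; first by rewrite mul0n GRing.addr0.
by rewrite expgS autME IH tl; congr l; lia.
Qed.

(** * Compactness of sets of bounded displacement *)

Variable d : nat.
Hypothesis regV : regular_graph e d.

Lemma ball_finite x n : finite_set [set y | gdist x y <= n].
Proof.
elim: n => [|n IH].
  apply: sub_finite_set (finite_set1 x) => y /=.
  by rewrite leqn0 => /eqP/gdist_eq0 ->.
have finN z : finite_set [set y | e z y] by exists d; exact: regV.
apply: sub_finite_set (_ : finite_set ([set x] `|`
  \bigcup_(z in [set z | gdist x z <= n]) [set y | e z y])).
  move=> y /= xy.
  have [->|/exists_closer[z eyz xz]] := eqVneq y x; first by left.
  by right; exists z => /=; [lia|rewrite edge_sym].
by rewrite finite_setU; split; [exact: finite_set1|exact: bigcup_finite].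
Qed.

Lemma ultra_finite (T : Type) (F : set_system T) (f : T -> V) (A : set V) :
  UltraFilter F -> finite_set A -> F (f @^-1` A) ->
  exists a, F (f @^-1` [set a]).
Proof.
move=> FU /finite_seqP[s ->]; elim: s => [|a s IH] Fs.
  by have [t] := filter_ex Fs; rewrite /= in_nil.
have [Fa|Fna] := in_ultra_setVsetC (f @^-1` [set a]) FU; first by exists a.
apply: IH; apply: filterS2 Fna Fs => t /= ta.
by rewrite inE => /predU1P[|].
Qed.

(** Since compact subsets of a discrete space are finite, pointwise
    convergence implies convergence in the compact-open topology. *)
Lemma aut_cvg (F : set_system (aut e)) g : Filter F ->
  (forall x, F [set h : aut e | h x = g x]) -> F --> g.
Proof.
move=> FF Fg A [_ [[B oB <-]] /= Bg BA].
apply: filterS BA _.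
suff : @aut_embed V e @ F --> aut_embed g by apply; exact: open_nbhs_nbhs.
apply/compact_open_cvgP => K O cK _ gKO.
have near_K : \forall h \near F, K `<=` (fun x => O (aut_embed h x)).
  apply: (iffLR (compact_near_coveringP K) cK) => x Kx.
  exists ([set x], [set h : aut e | h x = g x]).
    by split; [exact: discrete_set1|exact: Fg].
  by move=> [_ h] [/= -> hx]; rewrite /aut_embed hx; apply: gKO; exists x.
by apply: filterS near_K => h hK _ [x Kx <-]; exact: hK.
Qed.

Lemma set_val_continuous (gT : topologicalGroupType) (H : subgroup gT) :
  continuous (@set_val _ H : set_type H -> gT).
Proof. exact: initial_continuous. Qed.

Variable G : subgroup (aut e).

(** The inclusion of [G]; a name for it fixes the type at which it is applied
    to vertices. *)
Definition aut_of (g : set_type G) : aut e := set_val g.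

(** If [x] is displaced boundedly then so is every vertex, and the same is
    true of the inverses. Balls being finite, an ultrafilter stabilises the
    image of each vertex under the elements and under their inverses; the two
    limit maps are inverse to each other. *)
Lemma ultra_limit (F : set_system (set_type G)) x n : UltraFilter F ->
  F [set g | gdist x (aut_of g x) <= n] ->
  exists h, forall y, F [set g | aut_of g y = h y].
Proof.
move=> FU Fn.
have Fball (f : set_type G -> V) v m : F [set g | gdist v (f g) <= m] ->
    exists w, F [set g | f g = w].
  move=> ?; apply: (@ultra_finite _ F f [set w | gdist v w <= m]) => //.
  exact: ball_finite.
have bound g v : gdist x (g x) <= n ->
    gdist v (g v) <= gdist v x + n + gdist x v.
  move=> gx; have := gdist_triangle v x (g v).
  have := gdist_triangle x (g x) (g v).
  by rewrite aut_gdist; lia.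
have /choice[h hP] : forall v, exists w, F [set g | aut_of g v = w].
  move=> v; apply: (Fball _ v (gdist v x + n + gdist x v)).
  by apply: filterS Fn => g /= gx; exact: bound.
have /choice[h' h'P] : forall v, exists w, F [set g | (aut_of g)^-1%g v = w].
  move=> v; apply: (Fball _ v (gdist v x + n + gdist x v)).
  apply: filterS Fn => g gx; apply: (bound (aut_of g)^-1%g).
  by rewrite -(aut_gdist (aut_of g)) autVK gdistC.
have hK : cancel h h'.
  move=> v; have [g [gv g'v]] := filter_ex (filterI (hP v) (h'P (h v))).
  by rewrite -g'v -gv autKV.
have h'K : cancel h' h.
  move=> v; have [g [g'v gv]] := filter_ex (filterI (h'P v) (hP (h' v))).
  by rewrite -gv -g'v autVK.
have he u v : e (h u) (h v) = e u v.
  by have [g [/= <- <-]] := filter_ex (filterI (hP u) (hP v)); rewrite aut_edge.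
by exists (Aut hK h'K he).
Qed.

Hypothesis G_closed : closed G.

Lemma displacement_compact x n :
  compact [set g : set_type G | gdist x (aut_of g x) <= n].
Proof.
rewrite compact_ultra => F FU Fn; have [h hP] := ultra_limit FU Fn.
have Fh : aut_of @ F --> h by apply: aut_cvg.
have Gh : subgroup_set G h.
  apply: (closed_cvg _ G_closed _ _ Fh).
  by apply: nearW => g; exact: set_mem (valP g).
exists (SigSub (mem_set Gh)); split.
  by have [g [/= ? <-]] := filter_ex (filterI Fn (hP x)).
move=> A [_ [[B oB <-]] /= Bh BA]; apply: filterS BA _.
by apply: Fh; exact: open_nbhs_nbhs.
Qed.

Lemma displacement_closed x n :
  closed [set g : set_type G | gdist x (aut_of g x) <= n].
Proof.
move=> g cg.
have ng : nbhs g (aut_of @^-1` [set h : aut e | h x = aut_of g x]).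
  exact: (set_val_continuous (nbhs_aut _ _)).
by have [h [/= + <-]] := cg _ ng.
Qed.

(** * Escaping to infinity in a branching tree *)

Hypothesis d3 : 3 <= d.

Lemma third_neighbour x a b : exists y, [/\ e x y, y <> a & y <> b].
Proof.
have [f [_ _ fsurj]] : exists f, set_bij [set y | e x y] `I_d f.
  by apply/card_set_bijP; exact: regV.
have pre i : i < 3 -> exists2 y, e x y & f y = i.
  by move=> i3; exact: fsurj (leq_trans i3 d3).
have [y0 ey0 f0] := pre 0 isT.
have [y1 ey1 f1] := pre 1 isT.
have [y2 ey2 f2] := pre 2 isT.
have [y0a|/eqP y0a] := eqVneq y0 a.
  have [y1b|/eqP y1b] := eqVneq y1 b; last by exists y1; split=> //; congruence.
  by exists y2; split=> //; congruence.
have [y0b|/eqP y0b] := eqVneq y0 b; last by exists y0.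
have [y1a|/eqP y1a] := eqVneq y1 a; last by exists y1; split=> //; congruence.
by exists y2; split=> //; congruence.
Qed.

(** The exception [a] is the neighbour of [b] closer to [x], and does not
    exist when [b = x]; any value will do then. *)
Lemma all_but_one_farther x b : exists a, forall z, e b z -> z <> a ->
  gdist x z = (gdist x b).+1.
Proof.
have [[a [eba ab]]|no] :=
  pselect (exists a, e b a /\ gdist x b = (gdist x a).+1).
  exists a => z ebz za; have [//|bz] := gdist_edgeE x ebz.
  by case: za; apply: (@closer_unique x b); rewrite ?ab ?bz //; lia.
exists x => z ebz _; have [//|bz] := gdist_edgeE x ebz.
by case: no; exists z.
Qed.

(** At each vertex at most one neighbour is not farther from [x] and at most
    one is not farther from [y], so degree 3 leaves a step going away from
    both. *)
Lemma exists_escaping_ray x y b : exists r,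
  [/\ r 0 = b, forall n, e (r n) (r n.+1),
      forall n, gdist x (r n) = gdist x b + n &
      forall n, gdist y (r n) = gdist y b + n].
Proof.
have next c :
    {z | [/\ e c z, gdist x z = (gdist x c).+1 & gdist y z = (gdist y c).+1]}.
  apply: cid; have [a ac] := all_but_one_farther x c.
  have [a' ac'] := all_but_one_farther y c.
  by have [z [ecz za za']] := third_neighbour c a a'; exists z; split; auto.
pose f c := proj1_sig (next c).
have fP c : [/\ e c (f c), gdist x (f c) = (gdist x c).+1
  & gdist y (f c) = (gdist y c).+1] := proj2_sig (next c).
exists (fun n => iter n f b); split=> //.
- by move=> n; have [] := fP (iter n f b).
- elim=> [|n IH] /=; first by rewrite addn0.
  by have [_ -> _] := fP (iter n f b); rewrite IH addnS.
- elim=> [|n IH] /=; first by rewrite addn0.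
  by have [_ _ ->] := fP (iter n f b); rewrite IH addnS.
Qed.

Lemma ray_extend_back x n (s : nat -> V) : (forall k, e (s k) (s k.+1)) ->
  (forall k, gdist x (s k) = n + k) ->
  exists r, [/\ reduced r, r 0 = x & forall k, r (n + k) = s k].
Proof.
elim: n s => [|n IH] s es xs.
  have s0 : s 0 = x by apply/esym/gdist_eq0; rewrite xs.
  exists s; split=> //; apply: (away_reduced (x := x)) => // k.
  by rewrite !xs.
have ys : s 0 != x.
  by apply: contraPneq (xs 0) => ->; rewrite gdistxx; lia.
have [z esz] := exists_closer ys; rewrite xs => -[nz].
pose s' k := if k is k'.+1 then s k' else z.
have es' k : e (s' k) (s' k.+1) by case: k => [|k] //=; rewrite edge_sym.
have [|r [rr r0 rn]] := IH s' es'; first by case=> [|k] /=; rewrite ?xs; lia.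
by exists r; split=> // k; rewrite addSnnS rn.
Qed.

Lemma ray_through x y : exists r, [/\ reduced r, r 0 = x & r (gdist x y) = y].
Proof.
have [s [s0 es xs _]] := exists_escaping_ray x x y.
have [r [rr r0 rn]] := ray_extend_back es xs.
by exists r; split=> //; rewrite -[gdist x y]addn0 rn.
Qed.

(** Go back [m] steps from [y] towards [x], then [m] steps along a ray
    escaping both [x] and [y]. *)
Lemma sphere_pair x y m : m <= gdist x y ->
  exists z, gdist x z = gdist x y /\ gdist y z = m.*2.
Proof.
move=> my; have [q [rq q0 qn]] := ray_through x y.
pose p := q (gdist x y - m).
have xp : gdist x p = gdist x y - m.
  by rewrite -{1}q0 (reduced_gdist 0 _ rq).
have yp : gdist y p = m.
  by have := reduced_gdist (gdist x y - m) m rq; rewrite subnK // qn gdistC.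
have [r [_ _ xr yr]] := exists_escaping_ray x y p.
by exists (r m); rewrite xr yr xp yp; lia.
Qed.

Lemma exists_line : exists l, geodesic_line l.
Proof.
have [x _] : exists x : V, True by case: treeV => _ [].
have [r [r0 er xr _]] := exists_escaping_ray x x x.
have [q [q0 eq r1q _]] := exists_escaping_ray (r 1) x x.
have xr' n : gdist x (r n) = gdist x (r 0) + n by rewrite xr r0.
have rr := away_reduced er xr'.
have rq : reduced q by apply: (away_reduced (x := r 1)) => // n; rewrite r1q q0.
exists (glue q r); apply: glue_line => //; first by rewrite q0.
by move=> q1; have := r1q 1; rewrite q1 gdistxx; lia.
Qed.

Lemma fork l : geodesic_line l -> exists l', [/\ geodesic_line l',
  forall k : int, (k <= 0)%R -> l' k = l k & l' 1%R <> l 1%R].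
Proof.
move=> ll; have [_ rn] := geodesic_line_half ll.
have [r [r0 er r1 rn1]] := exists_escaping_ray (l 1%R) (l (-1)%R) (l 0%R).
have rr : reduced r.
  by apply: (away_reduced (x := l 1%R)) => // n; rewrite r1 r0.
exists (glue (fun n => l (- n%:Z)%R) r); split.
- apply: (glue_line rn rr); first by rewrite r0 GRing.oppr0.
  by move=> eq1; have := rn1 1; rewrite -eq1 gdistxx; lia.
- by move=> [[|n]|n] k0 /=; [rewrite r0|lia|rewrite NegzE].
- by move=> /= eq1; have := r1 1; rewrite eq1 gdistxx; lia.
Qed.

(** Let [tau] be the minimal displacement, attained at [a]; it is at least 2
    by parity. The images under the powers of [t] of a segment [p] from [a]
    to [t a] form a walk that does not backtrack: inside a segment this is
    clear, and if it did so at [t a], then [p 1] would be displaced by at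
    most [tau - 2]. *)
Lemma axis t : (forall x, t x <> x) -> (forall x, ~~ odd (gdist x (t x))) ->
  exists l tau, [/\ geodesic_line l, 0 < tau &
    forall k : int, t (l k) = l (k + tau%:Z)%R].
Proof.
move=> fixfree even_t.
have [x0 _] : exists x : V, True by case: treeV => _ [].
have ex : exists n, `[< exists x, gdist x (t x) = n >].
  by exists (gdist x0 (t x0)); apply/asboolP; exists x0.
have [tau /asboolP[a ta] min_tau] := ex_minnP ex.
have {}min_tau x : tau <= gdist x (t x).
  by apply: min_tau; apply/asboolP; exists x.
have tau2 : 1 < tau.
  case: tau {min_tau} ta => [/gdist_eq0/esym/fixfree//|[|//]] ta.
  by have := even_t a; rewrite ta.
have [p [pr p0 pt]] := ray_through a (t a); rewrite ta in pt.
pose l (k : int) := int_power t (k %/ tau)%Z (p `|(k %% tau)%Z|).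
(* For [i = tau] this is the passage from one segment to the next. *)
have lE (q : int) i : i <= tau -> l (q * tau%:Z + i%:Z)%R = int_power t q (p i).
  rewrite leq_eqVlt => /predU1P[->|lti]; rewrite /l.
    have -> : (q * tau%:Z + tau%:Z = (q + 1) * tau%:Z + 0)%R by lia.
    rewrite divzMDl ?modzMDl; last lia.
    by rewrite div0z mod0z GRing.addr0 int_powerD1 autME p0 pt.
  rewrite divzMDl ?modzMDl; last lia.
  by rewrite divz_small ?modz_small ?GRing.addr0 //; lia.
have euclid (k : int) : exists q i, i < tau /\ k = (q * tau%:Z + i%:Z)%R.
  exists (k %/ tau)%Z, `|(k %% tau)%Z|.
  have tau0 : (tau%:Z <> 0)%R by lia.
  have := modz_ge0 k (introN eqP tau0); have := ltz_mod k (introN eqP tau0).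
  by have := divz_eq k tau; lia.
have [ep _] := pr.
exists l, tau; split; last 1 first.
- move=> k; have [q [i [lti ->]]] := euclid k.
  have -> : (q * tau%:Z + i%:Z + tau%:Z = (q + 1) * tau%:Z + i%:Z)%R by lia.
  by rewrite !(lE _ _ (ltnW lti)) int_powerD1 int_power_comm.
- apply: geodesic_lineP => k; have [q [i [lti ->]]] := euclid k.
    have -> : (q * tau%:Z + i%:Z + 1 = q * tau%:Z + i.+1%:Z)%R by lia.
    by rewrite (lE _ _ (ltnW lti)) (lE _ _ lti) aut_edge.
  have [lti2|] := ltnP i.+1 tau.
    have -> : (q * tau%:Z + i%:Z + 2 = q * tau%:Z + i.+2%:Z)%R by lia.
    rewrite (lE _ _ (ltnW lti)) (lE _ _ lti2) => /aut_inj.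
    by case: pr => _; apply.
  move=> gei; have ei : tau = i.+1 by lia.
  have -> : (q * tau%:Z + i%:Z + 2 = (q + 1) * tau%:Z + 1%:Z)%R by lia.
  rewrite (lE _ _ (ltnW lti)) (lE _ _ (ltnW tau2)) int_powerD1 autME.
  move=> /aut_inj tp1.
  have := min_tau (p 1); rewrite -tp1.
  have -> : i = 1 + (tau - 2) by lia.
  by rewrite (reduced_gdist _ _ pr); lia.
- by lia.
Qed.

(** * Translations and transitivity on spheres *)

Hypothesis G_even : G `<=` type_preserving e.
Hypothesis G_trans : two_transitive_on_boundary G.

(** A pair of distinct ends determines the line joining them, up to a shift. *)
Lemma line_transitive l l' : geodesic_line l -> geodesic_line l' ->
  exists2 g, subgroup_set G g &
    exists c : int, forall k, g (l k) = l' (k + c)%R.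
Proof.
move=> ll ll'.
have [rp rn] := geodesic_line_rays ll.
have [rp' rn'] := geodesic_line_rays ll'.
have bd r : ray e r -> boundary e (end_of e r) by move=> rr; exists r.
have self r : ray e r -> end_of e r r by split=> //; exists 0, 0.
have [g Gg [gp gn]] := G_trans (bd _ rp) (bd _ rn) (bd _ rp') (bd _ rn')
  (geodesic_line_ends ll) (geodesic_line_ends ll').
exists g => //; apply: (lines_same_ends (l := g \o l)) => //.
- by move=> i j; rewrite aut_gdist.
- have : end_act g (end_of e (fun n => l (Posz n))) (g \o fun n => l (Posz n)).
    by exists (fun n => l (Posz n)) => //; exact: self.
  by rewrite gp => -[].
- have : end_act g (end_of e (fun n => l (- n%:Z)%R))
      (g \o fun n => l (- n%:Z)%R).
    by exists (fun n => l (- n%:Z)%R) => //; exact: self.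
  by rewrite gn => -[].
Qed.

(** The reversal of a line has a fixed vertex in its middle rather than a
    flipped edge because displacements are even. *)
Lemma exists_no_fixpoint : exists2 t, subgroup_set G t & forall u, t u <> u.
Proof.
have [l0 ll0] := exists_line.
have [s Gs [c0 sl0]] := line_transitive ll0 (geodesic_line_opp ll0).
(* [l0 j] is the midpoint of [l0 0] and its image. *)
have [j cj] : exists j : int, (c0 = - (j + j))%R.
  have := type_preserving_even (l0 0%R) (G_even Gs); rewrite sl0 ll0.
  by move=> ev; exists (- (c0 %/ 2)%Z)%R; lia.
pose l (k : int) := l0 (k + (j - 1))%R.
have ll : geodesic_line l by exact: geodesic_line_shift.
have sl k : s (l k) = l (2 - k)%R by rewrite /l sl0; congr l0; lia.
have [l' [ll' l'l l'1]] := fork ll.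
have [g Gg [a gl]] := line_transitive ll ll'.
have [a0|/eqP a0] := eqVneq a 0%R; last first.
  exists g => //; apply: (@shift_ray_no_fixpoint g l a) => // k k0 ka.
  by rewrite gl l'l.
pose s' := (g * s * g^-1)%g.
have s'l' k : s' (l' k) = l' (2 - k)%R.
  have gl' i : g (l i) = l' i by rewrite gl a0 GRing.addr0.
  by rewrite /s' !autME -!gl' autKV sl gl'.
exists (s * s')%g.
  apply: subgroupM => //.
  by apply: subgroupM; [exact: subgroupM|exact: subgroupV].
apply: (@two_reflections_no_fixpoint s s' (l 0%R) (l 1%R) (l' 1%R)).
- by rewrite edge_sym; exact: geodesic_line_edge.
- by rewrite edge_sym -l'l //; exact: geodesic_line_edge.
- by move/esym.
- by rewrite sl.
- by rewrite s'l'.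
- by rewrite sl => /(geodesic_line_inj ll).
- by rewrite -l'l // s'l' => /(geodesic_line_inj ll').
Qed.

(** The lines form a single orbit of [G], so an element translating one of
    them has conjugates translating the others by the same amount. That [tau]
    does not depend on the line is what [sphere_transitive] needs. *)
Lemma uniform_translations : exists2 tau, 0 < tau & forall l, geodesic_line l ->
  exists2 t, subgroup_set G t & forall k : int, t (l k) = l (k + tau%:Z)%R.
Proof.
have [t Gt t_free] := exists_no_fixpoint.
have [l0 [tau [ll0 tau0 tl0]]] :=
  axis t_free (fun x => type_preserving_even x (G_even Gt)).
exists tau => // l ll; have [g Gg [c gl]] := line_transitive ll0 ll.
exists (g * t * g^-1)%g.
  by apply: subgroupM; [exact: subgroupM|exact: subgroupV].
move=> k; have -> : l k = g (l0 (k - c)%R) by rewrite gl GRing.subrK.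
by rewrite !autME autKV tl0 gl; congr l; lia.
Qed.

Lemma subgroupX (gT : groupType) (H : subgroup gT) (x : gT) n :
  subgroup_set H x -> subgroup_set H (x ^+ n)%g.
Proof.
move=> Hx; elim: n => [|n IH]; first exact: subgroup1.
by rewrite expgS; exact: subgroupM.
Qed.

(** The two lines through [x] share their negative half, into which [n] steps
    of translation push the segment from [x] to [y]; the other translation
    then brings it out again as the segment from [x] to [y']. *)
Lemma sphere_transitive x y y' : gdist x y = gdist x y' ->
  exists k, [/\ subgroup_set G k, k x = x & k y = y'].
Proof.
move=> yy'; pose n := gdist x y.
have [n0|n0] := posnP n.
  exists 1%g; split=> //; first exact: subgroup1.
  by rewrite -(gdist_eq0 n0) (@gdist_eq0 x y') // -yy'.
have [q [q0 eq yq y'q]] := exists_escaping_ray y y' x.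
have rq : reduced q by apply: (away_reduced (x := y)) => // m; rewrite yq q0.
have line_to z : gdist x z = n -> (forall m, gdist z (q m) = gdist z x + m) ->
    exists l, [/\ geodesic_line l, l (Posz n) = z &
      forall m, l (- m%:Z)%R = q m].
  move=> xz zq; have [r [rr r0]] := ray_through x z; rewrite xz => rn.
  exists (glue q r); split=> //.
    apply: glue_line => //; first by rewrite q0.
    move=> q1; have := zq 1; rewrite q1 gdistC (gdistC z) xz -{1}rn.
    have {1}-> : n = 1 + n.-1 by lia.
    by rewrite (reduced_gdist _ _ rr); lia.
  by case=> [|m]; rewrite ?GRing.oppr0 //= ?r0 // -NegzE.
have [l [ll ln lq]] := line_to y erefl yq.
have [l' [ll' ln' lq']] := line_to y' (esym yy') y'q.
have [tau tau0 trans] := uniform_translations.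
have [t Gt tl] := trans l ll; have [t' Gt' tl'] := trans l' ll'.
pose h := (t' ^+ n * (t ^- n))%g.
have hl (k : int) : (k <= n%:Z)%R -> h (l k) = l' k.
  move=> kn; pose i := (k - (n * tau)%N%:Z)%R.
  have i0 : (i <= 0)%R by rewrite /i; nia.
  have ei : i = (- `|i|%N%:Z)%R by lia.
  have il : l i = l' i by rewrite ei lq lq'.
  rewrite /h autME.
  have -> : k = (i + (n * tau)%N%:Z)%R by rewrite GRing.subrK.
  by rewrite -(iter_translation n i tl) autKV il (iter_translation n i tl').
exists h; split.
- by apply: subgroupM; [exact: subgroupX|apply: subgroupV; exact: subgroupX].
- have l0 : l 0%R = x by rewrite -q0 -(lq 0).
  have l'0 : l' 0%R = x by rewrite -q0 -(lq' 0).
  by rewrite -{1}l0 hl.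
- by rewrite -ln hl // ln'.
Qed.

(** The element [k2] is chosen so that [k2 (g x)] is at distance
    [gdist x (h x)] from [g^-1 x], so that [g * k2 * g] displaces [x] as far
    as [h] does. *)
Lemma product_reaches x g h : subgroup_set G g -> subgroup_set G h ->
  gdist x (h x) <= gdist x (g x) ->
  exists k1 k2 k3, [/\ subgroup_set G k1 /\ k1 x = x,
    subgroup_set G k2 /\ k2 x = x,
    subgroup_set G k3 /\ k3 x = x & h = (k1 * g * k2 * g * k3)%g].
Proof.
move=> Gg Gh hg.
have gV : gdist x (g^-1%g x) = gdist x (g x).
  by rewrite -(aut_gdist g) autVK gdistC.
pose m := (gdist x (h x))./2.
have m2 : m.*2 = gdist x (h x).
  by have := type_preserving_even x (G_even Gh); rewrite /m; lia.
have [|z [xz yz]] := @sphere_pair x (g^-1%g x) m; first by rewrite gV; lia.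
have [k2 [Gk2 k2x k2g]] :
    exists k, [/\ subgroup_set G k, k x = x & k (g x) = z].
  by apply: sphere_transitive; rewrite xz gV.
have gkg : gdist x ((g * k2 * g)%g x) = gdist x (h x).
  by rewrite -m2 -yz !autME k2g -[in RHS](aut_gdist g) autVK.
have [k1 [Gk1 k1x k1h]] := sphere_transitive gkg.
exists k1, k2, ((k1 * g * k2 * g)^-1 * h)%g; split=> //; last by rewrite mulVKg.
split; first by do ?[apply: subgroupM => //|apply: subgroupV].
have -> : (k1 * g * k2 * g = k1 * (g * k2 * g))%g by rewrite !mulgA.
by rewrite autME -k1h -(autME k1) autKV.
Qed.

End Tree.

(** * Length functions *)

Theorem corollary7p4 (R : realType) (V : choiceType) (e : rel V) (d : nat)
    (G : subgroup (aut e)) :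
  (3 <= d)%N -> regular_tree e d ->
  closed G -> ~ compact G -> G `<=` type_preserving e ->
  two_transitive_on_boundary G ->
  property_PL R (set_type G).
Proof.
move=> d3 [treeV regV] G_closed _ G_even G_trans L [L0 Lcpt LV LM].
have [x _] : exists x : V, True by case: treeV => _ [].
pose D n := [set g : set_type G | gdist e x (aut_of g x) <= n].
have Dcpt n : compact (D n).
  exact: (displacement_compact treeV regV G_closed).
have [|] := pselect (proper_length L); first by right.
move=> /existsNP[r /not_implyP[_ nonprecompact]]; left.
have far n : exists2 g : set_type G, (L g <= r)%R & n < gdist e x (aut_of g x).
  apply: contrapT => no_far; apply: nonprecompact.
  exists (D n); last by split=> //; exact: displacement_closed.
  move=> g /= Lg; rewrite /D /= leqNgt; apply/negP => ng.
  by apply: no_far; exists g.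
(* [D 0] is the stabiliser of [x]. *)
have [C stabC] := Lcpt _ (Dcpt 0).
exists (C + r + C + r + C)%R => h.
have [g Lg /ltnW hg] := far (gdist e x (aut_of h x)).
have [k1 [k2 [k3 [[Gk1 k1x] [Gk2 k2x] [Gk3 k3x] hE]]]] :=
  product_reaches treeV regV d3 G_even G_trans
    (set_mem (valP g)) (set_mem (valP h)) hg.
pose lift k (Gk : subgroup_set G k) : set_type G := SigSub (mem_set Gk).
have lift_le k (Gk : subgroup_set G k) : k x = x -> (L (lift k Gk) <= C)%R.
  by move=> kx; apply: stabC; rewrite /D /= /aut_of /= kx gdistxx.
have -> : h = (lift _ Gk1 * g * lift _ Gk2 * g * lift _ Gk3)%g.
  by exact: val_inj.
do 4![apply: (Order.POrderTheory.le_trans (LM _ _));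
      apply: Num.Theory.lerD; last by try exact: lift_le].
exact: lift_le.
Qed.
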